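(* Let $\alpha,\beta\in\mathbb{R}\setminus\mathbb{Q}$, and let $h:\mathbb{R}\to\mathbb{R}$ be a $1$-periodic $C^\infty$-smooth function. Let $T:\mathbb{T}^\omega\to\mathbb{T}^\omega$ be the map $$T:(x_1,x_2,\ldots,x_k,\ldots)\mapsto (x_1+\alpha,\ x_2+h(x_1),\ \ldots,\ x_k+h(x_1+(k-2)\beta),\ \ldots),$$ that is, the first coordinate of $T(x)$ is $x_1+\alpha$ and, for every $k\geqslant 2$, the $k$-th coordinate of $T(x)$ is $x_k+h(x_1+(k-2)\beta)$ (all modulo $1$). Then the measure complexity of $(\mathbb{T}^\omega,T,\nu)$ is sub-polynomial for every $\nu\in M(\mathbb{T}^\omega,T)$.
   Context: $\mathbb{T}=\mathbb{R}/\mathbb{Z}$, and $\mathbb{T}^\omega=\prod_{\mathbb{N}}\mathbb{T}$ is the infinite-dimensional torus: the product of countably many copies of $\mathbb{T}$ (indexed by the positive integers), with the product topology. This topology is induced by the metric $$d(x,y)=\sum_{k=1}^\infty\frac{1}{2^k}\|x_k-y_k\|,$$ where $x_k,y_k$ are the $k$-th components of $x,y$ and $\|t\|=\min_{n\in\mathbb{Z}}|t-n|$ is the distance to the nearest integer. For a compact space $X$ whose topology is induced by a metric $d$, and a homeomorphism $T:X\to X$, $M(X,T)$ denotes the set of all $T$-invariant Borel probability measures on $X$. For $n\in\mathbb{N}$ (positive integers) and $x,y\in X$ put $$\bar d_n(x,y)=\frac1n\sum_{j=0}^{n-1}d(T^j(x),T^j(y)),\qquad B_{\bar d_n}(x,\varepsilon)=\{y\in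 X:\bar d_n(x,y)<\varepsilon\}.$$ For $\nu\in M(X,T)$ and $\varepsilon>0$ define $$s_n(d,\nu,\varepsilon)=\min\Big\{m\in\mathbb{N}:\ \nu\Big(\bigcup_{j=1}^m B_{\bar d_n}(x_j,\varepsilon)\Big)>1-\varepsilon\ \text{ for some } x_1,\ldots,x_m\in X\Big\}.$$ The measure complexity of $(X,T,\nu)$ is sub-polynomial if for every $\tau>0$ and every $\varepsilon>0$, $$\liminf_{n\to\infty}\frac{s_n(d,\nu,\varepsilon)}{n^\tau}=0.$$ *)

(* Defs.v *)
From HB Require Import structures.
From mathcomp Require Import all_boot all_order all_algebra.
From mathcomp Require Import all_classical all_reals all_analysis.
Set Implicit Arguments.
Unset Strict Implicit.
Unset Printing Implicit Defensive.
Import Order.TTheory GRing.Theory Num.Theory.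
Import numFieldNormedType.Exports.
Local Open Scope classical_set_scope.
Local Open Scope ring_scope.
Local Open Scope quotient_scope.

Notation borel X := (g_sigma_algebraType (@open X)).

Section Complexity.
Context {R : realType} (X : ptopologicalType).

(* M(X, T) *)
Definition invariant_measures (T : X -> X) : set (probability (borel X) R) :=
  [set nu | forall A : set (borel X),
     measurable A -> nu ((T : borel X -> borel X) @^-1` A) = nu A].

Variables (d : X -> X -> R) (T : X -> X).

Definition dbar (n : nat) (x y : X) : R :=
  n%:R^-1 * \sum_(0 <= j < n) d (iter j T x) (iter j T y).

Definition dbar_ball (n : nat) (x : X) (e : R) : set X :=
  [set y | dbar n x y < e].

Local Open Scope ereal_scope.

(* The infimum of a nonempty set of positive integers is its minimum; the value
   is +oo when no finite family of balls is large enough. *)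
Definition span_number (nu : set (borel X) -> \bar R) (n : nat) (e : R) : \bar R :=
  ereal_inf [set (m%:R)%:E | m in [set m : nat | (0 < m)%N /\
    exists x : 'I_m -> X,
      nu (\bigcup_(j in [set: 'I_m]) dbar_ball n (x j) e) > (1 - e)%:E]].

(* The sequence is indexed from n = 1. *)
Definition subpolynomial_complexity (nu : set (borel X) -> \bar R) : Prop :=
  forall tau e : R, (0 < tau)%R -> (0 < e)%R ->
    limn_einf (fun n : nat =>
      span_number nu n.+1 e * ((n.+1%:R `^ tau)^-1)%:E) = 0.

End Complexity.

Section Torus.
Variable R : realType.

(* Num.int_num_subdef is the predicate underlying the qualifier Num.int. *)
Definition integers : zmodClosed R :=
  GRing.ZmodClosed.clone R Num.int_num_subdef _.

(* R / Z as an additive group, with the quotient topology. *)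
Definition circle : Type := quotient_topology (Quotient.quot integers).

HB.instance Definition _ := PointedTopological.on circle.
HB.instance Definition _ := Quotient.on circle.
HB.instance Definition _ :=
  GRing.Zmodule.copy circle (Quotient.quot integers).

Definition to_circle (t : R) : circle := \pi_circle t.

(* The infimum is attained: this is the distance to the nearest integer. *)
Definition dist_int (t : R) : R := inf [set `|t - n%:~R| | n in [set: int]].

Definition circle_norm (x : circle) : R := dist_int (repr x).

(* Component k : nat of a point is its coordinate x_(k+1). *)
Definition torus : Type := prod_topology (fun _ : nat => circle).

HB.instance Definition _ := Topological.on torus.
HB.instance Definition _ := isPointed.Build torus (fun=> point).

Definition torus_dist (x y : torus) : R :=
  limn (series (fun k : nat => (2 ^+ k.+1)^-1 * circle_norm (x k - y k))).

(* For 1-periodic h, h (repr (x 0) + _) does not depend on the representative;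
   see torus_mapE. *)
Definition torus_map (alpha beta : R) (h : R -> R) (x : torus) : torus :=
  fun k => match k with
  | 0%N => x 0%N + to_circle alpha
  | j.+1 => x j.+1 + to_circle (h (repr (x 0%N) + j%:R * beta))
  end.

Lemma to_circleP (s t : R) :
  reflect (to_circle s = to_circle t) (s - t \is a Num.int).
Proof.
rewrite -[_ \is a _]/(s - t \in integers) (Quotient.idealrBE integers).
by apply: (iffP eqP).
Qed.

Lemma repr_to_circle (t : R) : exists m : int, repr (to_circle t) = t + m%:~R.
Proof.
have : repr (to_circle t) - t \is a Num.int.
  by apply/to_circleP; rewrite /to_circle reprK.
by case/intrP => m mE; exists m; rewrite -mE addrC subrK.
Qed.

Lemma dist_intDz (t : R) (m : int) : dist_int (t + m%:~R) = dist_int t.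
Proof.
rewrite /dist_int; congr inf; apply/seteqP; split=> _ [n _ <-].
  by exists (n - m) => //; rewrite rmorphB /= opprB addrA.
by exists (n + m) => //; rewrite rmorphD /= (addrC n%:~R) addrKA.
Qed.

Lemma circle_normE (t : R) : circle_norm (to_circle t) = dist_int t.
Proof.
by rewrite /circle_norm; have [m ->] := repr_to_circle t; exact: dist_intDz.
Qed.

Lemma to_circleD (s t : R) : to_circle (s + t) = to_circle s + to_circle t.
Proof. by rewrite /to_circle !piE. Qed.

Lemma torus_mapE (alpha beta : R) (h : R -> R) (u : nat -> R) :
  periodic h 1 ->
  torus_map alpha beta h (fun k => to_circle (u k)) =
  (fun k => to_circle (match k with
    | 0%N => u 0%N + alpha
    | j.+1 => u j.+1 + h (u 0%N + j%:R * beta)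
    end)).
Proof.
move=> h1; apply: funext => -[|j] /=; rewrite to_circleD//.
congr (_ + to_circle _); have [m ->] := repr_to_circle (u 0%N).
have hn n a : h (a + n%:R) = h a by exact: (periodicn h1).
by case: m => n; rewrite addrAC ?hn// NegzE mulrNz -(hn n.+1) subrK.
Qed.

End Torus.

Definition smooth (R : realType) (h : R -> R) : Prop :=
  forall (n : nat) (x : R), derivable (derive1n n h) x 1.

(* Main.v *)
(* The n-th iterate of T adds to each further coordinate a Birkhoff sum
   S_n h(x) = h(x) + h(x + alpha) + ... + h(x + (n-1) alpha), so the whole torus
   is covered by O(L) balls of radius e for dbar_n, where L >= 1 bounds |S_j h'|
   for j <= n.  It remains to find, for every tau > 0, infinitely many n with
   L = O(n^tau).

   If p/q is in lowest terms, the sum of h' along the orbit of p/q is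
   1/q-periodic, and so are its antiderivative and derivatives; by Rolle's
   theorem its sup norm is O(q^-r) for every r.  When |q alpha - p| < 1/Q,
   comparing with the rotation by p/q gives |S_q h'| = O(q^-r + q/Q).  Take the
   denominators q <= Q given by Dirichlet's theorem for Q = 2^k.  Either
   q^(r+1) >= 2^k for all large k, and cutting an orbit of length 2^(k+1) into
   blocks of length q shows that L grows at most linearly in k; or
   q^(r+1) < 2^k for infinitely many k, and then n = q^(r+1) has L = O(q). *)
Require Import Defs.
From mathcomp Require Import all_boot all_order all_algebra.
From mathcomp Require Import all_classical all_reals all_analysis.
From mathcomp Require Import ring lra zify.
Set Implicit Arguments.
Unset Strict Implicit.
Unset Printing Implicit Defensive.
Import Order.TTheory GRing.Theory Num.Theory.
Import numFieldNormedType.Exports.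
Local Open Scope classical_set_scope.
Local Open Scope ring_scope.

(** * Uniform bounds for smooth periodic functions *)

Section SmoothPeriodic.
Variable R : realType.
Implicit Types (f df g h : R -> R) (a x y M L T tau : R).

Lemma periodicz f T (n : int) x : periodic f T -> f (x + n%:~R * T) = f x.
Proof.
move=> fT; case: n => n.
  by rewrite -[RHS](periodicn fT n) -pmulrn mulr_natl.
by rewrite NegzE mulrNz mulNr -pmulrn mulr_natl -(periodicn fT n.+1) subrK.
Qed.

Lemma periodic_derive1 f T : periodic f T -> periodic (derive1 f) T.
Proof.
by move=> fT x; rewrite /derive1 fT; under eq_fun do rewrite addrA fT.
Qed.

Lemma periodic_derive1n f T n : periodic f T -> periodic (derive1n n f) T.
Proof. by move=> fT; elim: n => //= n /periodic_derive1. Qed.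

Lemma smooth_is_derive h n x :
  smooth h -> is_derive x 1 (derive1n n h) (derive1n n.+1 h x).
Proof. by move=> hs; rewrite derive1nS derive1E; exact/derivableP. Qed.

Lemma mvt_lipschitz f df M x y :
  (forall z : R, is_derive z 1 f (df z)) -> (forall z, `|df z| <= M) ->
  `|f x - f y| <= M * `|x - y|.
Proof.
move=> fdf dfM; wlog : x y / y <= x => [hw|yx].
  by have [|/ltW] := leP y x; [|rewrite distrC (distrC x)]; exact: hw.
have fc : {within `[y, x], continuous f}.
  by apply: derivable_within_continuous => z _; exact: ex_derive.
have [c _ ->] := MVT_segment yx (fun z _ => fdf z) fc.
by rewrite normrM ler_wpM2r.
Qed.

Lemma periodic_smooth_bounded h n : periodic h 1 -> smooth h ->
  exists2 M : R, 0 <= M & forall x, `|derive1n n h x| <= M.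
Proof.
move=> h1 hs.
have cf : {within `[0, 1], continuous (fun x => `|derive1n n h x|)}.
  move=> x; apply: continuous_comp; last exact: norm_continuous.
  apply: (@derivable_within_continuous _ _ (derive1n n h) `[0, 1]) => z _.
  exact: hs.
have [c _ hc] := EVT_max ler01 cf.
exists `|derive1n n h c| => // x.
rewrite -(periodicz (- Num.floor x) x (periodic_derive1n n h1)).
apply: hc; rewrite mulr1 mulrNz in_itv/=; have := floor_itv x.
by rewrite intrD; lra.
Qed.

(* A derivative of a [T]-periodic function vanishes in every window of
   length [T], by Rolle's theorem. *)
Lemma periodic_derive_le f df ddf T M x : 0 < T -> periodic f T ->
  (forall z : R, is_derive z 1 f (df z)) ->
  (forall z : R, is_derive z 1 df (ddf z)) ->
  (forall z, `|ddf z| <= M) -> `|df x| <= T * M.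
Proof.
move=> T0 fT fdf dfd ddM.
have fc : {within `[x, x + T], continuous f}.
  by apply: derivable_within_continuous => z _; exact: ex_derive.
have xT : x < x + T by rewrite ltrDl.
have [c cx] := MVT xT (fun z _ => fdf z) fc.
rewrite fT subrr addrAC subrr add0r => /esym/eqP; rewrite mulf_eq0.
rewrite (gt_eqF T0) orbF => /eqP dc0.
rewrite -[df x]subr0 -dc0; apply: le_trans (mvt_lipschitz x c dfd ddM) _.
rewrite mulrC ler_wpM2r//; first exact: le_trans (ddM 0).
by move: cx; rewrite in_itv/= distrC => /andP[xc cT]; rewrite gtr0_norm; lra.
Qed.

(** * Birkhoff sums and rational rotations *)

Definition birkhoff a f (n : nat) x : R := \sum_(i < n) f (x + i%:R * a).

Lemma is_derive_birkhoff a f df n x : (forall z : R, is_derive z 1 f (df z)) ->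
  is_derive x 1 (birkhoff a f n) (birkhoff a df n x).
Proof.
move=> fdf.
have -> : birkhoff a f n = \sum_(i < n) (f \o shift (i%:R * a)).
  by apply/funext => z; rewrite fct_sumE.
apply: is_derive_sum => i; rewrite -[df _]mulr1.
by apply: is_derive1_comp; exact: is_derive_shift.
Qed.

Lemma birkhoff_le a f M n x : (forall z, `|f z| <= M) ->
  `|birkhoff a f n x| <= n%:R * M.
Proof.
move=> fM; apply: le_trans (ler_norm_sum _ _ _) _.
apply: le_trans (ler_sum _ (fun i _ => fM _)) _.
by rewrite sumr_const card_ord mulr_natl.
Qed.

Lemma birkhoffD a f m n x :
  birkhoff a f (m + n) x = birkhoff a f m x + birkhoff a f n (x + m%:R * a).
Proof.
rewrite /birkhoff big_split_ord/=; congr (_ + _); apply: eq_bigr => i _.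
by rewrite natrD mulrDl addrA.
Qed.

Lemma birkhoff_periodic a f T n : periodic f T -> periodic (birkhoff a f n) T.
Proof.
by move=> fT x; apply: eq_bigr => i _; rewrite addrAC fT.
Qed.

(* With [p] and [q] coprime, the points [x + i p / q] sample the circle
   equidistantly. *)
Lemma birkhoff_rational_periodic f (p : int) (q : nat) : (0 < q)%N ->
  coprimez p q%:Z -> periodic f 1 ->
  periodic (birkhoff (p%:~R / q%:R) f q) (q%:R^-1).
Proof.
move=> q0 cpq f1; set a := p%:~R / q%:R.
have q0' : q%:R != 0 :> R by rewrite pnatr_eq0 -lt0n.
(* Shifting by [a] drops the first term [f x] and appends [f (x + q a)]; these agree because
   [q a = p] is an integer. *)
have pa : periodic (birkhoff a f q) a.
  move=> x; apply: (@addrI _ (birkhoff a f 1 x)).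
  have /= := birkhoffD a f 1 q x; rewrite mul1r => <-.
  rewrite addnC birkhoffD addrC; congr (_ + _).
  rewrite /birkhoff !big_ord1 !mul0r !addr0.
  by rewrite -(periodicz p x f1) mulr1 /a mulrCA divff// mulr1.
have p1 := @birkhoff_periodic a f 1 q f1.
(* Bezout's identity [u p + v q = 1] gives [1/q = u a + v], a combination of the two periods [a] and
   1. *)
have [u [v uv]] := Bezoutz p q%:Z.
have uvR : u%:~R * p%:~R + v%:~R * q%:R = 1 :> R.
  by rewrite (pmulrn _ q) -!intrM -intrD uv (eqP cpq).
move=> x; have -> : x + q%:R^-1 = x + u%:~R * a + v%:~R * 1.
  apply: (mulIf q0'); rewrite /a !mulrDl mulVf// mulr1 -addrA; congr (_ + _).
  by rewrite -mulrA divfK// uvR.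
by rewrite (periodicz _ _ p1) (periodicz _ _ pa).
Qed.

(* The sums of the derivatives of [h] over the orbit of [p / q] are
   [1/q]-periodic, so each further differentiation gains a factor [1/q]. *)
Lemma birkhoff_rational_le h (r : nat) : periodic h 1 -> smooth h ->
  exists2 M : R, 0 <= M & forall (p : int) (q : nat) x, (0 < q)%N ->
    coprimez p q%:Z ->
    `|birkhoff (p%:~R / q%:R) (derive1n 1 h) q x| <= M / q%:R ^+ r.
Proof.
move=> h1 hs; have [M M0 hM] := periodic_smooth_bounded r.+2 h1 hs.
exists M => // p q x q0 cpq; set a := p%:~R / q%:R.
have qR : 0 < q%:R :> R by rewrite ltr0n.
(* The induction descends from the derivative of order [r.+2], bounded term by term, to order 1.
   Each step uses the sum one order below the one being bounded as a periodic antiderivative, so the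
   last step uses the sum of [h] itself. *)
suff H k : (k <= r.+1)%N -> forall z,
    `|birkhoff a (derive1n (r.+2 - k) h) q z| <= M * q%:R / q%:R ^+ k.
  have := H r.+1 (leqnn _) x; rewrite subSnn exprS invfM mulrACA.
  by rewrite mulrA divfK ?gt_eqF.
elim: k => [|k IH] kr z.
  by rewrite subn0 expr0 divr1 mulrC; exact: birkhoff_le.
have D i y : is_derive y 1 (birkhoff a (derive1n i h) q)
    (birkhoff a (derive1n i.+1 h) q y).
  by apply: is_derive_birkhoff => w; exact: smooth_is_derive.
have per := birkhoff_rational_periodic q0 cpq (periodic_derive1n (r - k) h1).
have kE : (r.+2 - k = (r - k).+2)%N by rewrite !subSn// ltnW.
have qV : 0 < q%:R^-1 :> R by rewrite invr_gt0.
have := periodic_derive_le z qV per (D _) (D _) _.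
rewrite subSS subSn// => /(_ (M * q%:R / q%:R ^+ k)).
rewrite -kE => /(_ (IH (ltnW kr))) /le_trans; apply.
by rewrite exprS invfM mulrCA.
Qed.

(* Pigeonhole on the fractional parts of [i a], [i <= Q]. *)
Lemma dirichlet_approximation a (Q : nat) : (0 < Q)%N ->
  exists p : int, exists q : nat,
    [/\ (0 < q <= Q)%N, coprimez p q%:Z & `|q%:R * a - p%:~R| < Q%:R^-1].
Proof.
move=> Q0; have QR : 0 < Q%:R :> R by rewrite ltr0n.
pose fr (i : nat) : R := i%:R * a - (Num.floor (i%:R * a))%:~R.
have fr01 i : 0 <= fr i < 1.
  by have := floor_itv (i%:R * a); rewrite /fr intrD; lra.
pose box i := Num.trunc (fr i * Q%:R).
have boxP i : (box i)%:R <= fr i * Q%:R < (box i).+1%:R.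
  by apply: truncn_itv; rewrite mulr_ge0//; case/andP: (fr01 i).
have [i [j [ij jQ bij]]] :
    exists i j, [/\ (i < j)%N, (j <= Q)%N & box i = box j].
  apply: contrapT => H.
  suff : (Q.+1 <= Q)%N by rewrite ltnn.
  apply: (@pigeonhole _ _ box).
    move=> i j /set_mem/= iQ /set_mem/= jQ bij; apply: contrapT => /eqP.
    rewrite neq_ltn => /orP[] ltij; apply: H;
      by [exists i, j; split|exists j, i; split].
  move=> _ [i /= iQ <-]; rewrite /= -(ltr_nat R).
  have /andP[+ _] := boxP i; move/le_lt_trans; apply.
  by rewrite -[ltRHS]mul1r ltr_pM2r//; case/andP: (fr01 i).
(* The least admissible denominator is coprime to [p]: dividing both by their gcd does not increase
   [|q a - p|], so a nontrivial gcd would yield a smaller one. *)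
pose P q := (0 < q <= Q)%N && `[< exists p : int, `|q%:R * a - p%:~R| < Q%:R^-1 >].
have exP : exists q, P q.
  exists (j - i)%N; rewrite /P subn_gt0 ij leq_subLR (leq_trans jQ) ?leq_addl//=.
  apply/asboolP.
  exists (Num.floor (j%:R * a) - Num.floor (i%:R * a)).
  rewrite natrB ?(ltnW ij)// intrB -[ltRHS]mul1r ltr_pdivlMr//.
  rewrite -[X in _ * X < _](gtr0_norm QR) -normrM.
  have -> : ((j%:R - i%:R) * a - ((Num.floor (j%:R * a))%:~R -
    (Num.floor (i%:R * a))%:~R)) * Q%:R = fr j * Q%:R - fr i * Q%:R.
    by rewrite /fr; ring.
  have := boxP i; have := boxP j; rewrite -bij -natr1 ltr_norml; lra.
case: (ex_minnP exP) => q /andP[/andP[q0 qQ] /asboolP[p pq]] qmin.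
exists p, q; split=> //; first by rewrite q0.
have [p' pE] := dvdzP (dvdz_gcdl p q%:Z).
have /dvdnP[q' qE] : (gcdn `|p| q %| q)%N by exact: dvdn_gcdr.
rewrite /coprimez; set g := gcdn `|p| q in qE.
have gE : gcdz p q%:Z = g by [].
rewrite gE in pE *.
have g0 : (0 < g)%N by rewrite gcdn_gt0 q0 orbT.
have q'0 : (0 < q')%N by move: q0; rewrite qE muln_gt0 => /andP[].
suff qq' : (q <= q')%N by rewrite eqz_nat; nia.
apply: qmin; rewrite /P q'0 (leq_trans _ qQ) ?qE ?leq_pmulr//=.
apply/asboolP; exists p'; apply: le_lt_trans pq.
have gR : 1 <= g%:R :> R by rewrite ler1n.
rewrite {1}pE {1}qE natrM intrM -pmulrn.
rewrite mulrAC -mulrBl normrM (ger0_norm (le_trans ler01 gR)).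
by rewrite ler_peMr.
Qed.

(** * Comparison of a rotation with its rational approximants *)

Lemma birkhoff_perturb f df M a b n x :
  (forall z : R, is_derive z 1 f (df z)) -> (forall z, `|df z| <= M) ->
  `|birkhoff a f n x - birkhoff b f n x| <= n%:R ^+ 2 * (M * `|a - b|).
Proof.
move=> fdf dfM; rewrite /birkhoff -sumrB.
apply: le_trans (ler_norm_sum _ _ _) _.
rewrite expr2 -mulrA mulr_natl -[X in _ *+ X]card_ord -sumr_const.
apply: ler_sum => i _; apply: le_trans (mvt_lipschitz _ _ fdf dfM) _.
rewrite mulrCA ler_wpM2l//; first exact: le_trans (dfM 0).
rewrite opprD addrACA subrr add0r -mulrBr normrM normr_nat.
by rewrite ler_wpM2r// ler_nat ltnW.
Qed.

(** The rotation by [b = p/q] contributes [q^-r]. Since [|a - b| <= 1/(qQ)] and the [i]-th orbit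
    point moves by [i |a - b|], replacing [b] by [a] costs at most a constant times
    [q^2 / (qQ) = q/Q]. *)
Lemma birkhoff_approx_le h (r : nat) : periodic h 1 -> smooth h ->
  exists2 M : R, 0 <= M & forall a (p : int) (q Q : nat) x, (0 < q <= Q)%N ->
    coprimez p q%:Z -> `|q%:R * a - p%:~R| < Q%:R^-1 ->
    `|birkhoff a (derive1n 1 h) q x| <= M * (q%:R ^- r + q%:R / Q%:R).
Proof.
move=> h1 hs.
have [M1 M10 hM1] := birkhoff_rational_le r h1 hs.
have [M2 M20 hM2] := periodic_smooth_bounded 2 h1 hs.
exists (M1 + M2) => [|a p q Q x /andP[q0 qQ] cpq apq]; first exact: addr_ge0.
have qR : 0 < q%:R :> R by rewrite ltr0n.
pose b : R := p%:~R / q%:R.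
have ab : `|a - b| <= q%:R^-1 / Q%:R.
  rewrite -(ler_pM2l qR) mulrA mulfV ?gt_eqF// mul1r.
  rewrite -{1}(gtr0_norm qR) -normrM mulrBr /b mulrCA mulfV ?gt_eqF// mulr1.
  exact: ltW.
have -> : birkhoff a (derive1n 1 h) q x = birkhoff b (derive1n 1 h) q x +
    (birkhoff a (derive1n 1 h) q x - birkhoff b (derive1n 1 h) q x) by ring.
apply: le_trans (ler_normD _ _) _.
rewrite mulrDr; apply: lerD.
  apply: le_trans (hM1 _ _ _ q0 cpq) _.
  by rewrite ler_wpM2r ?invr_ge0 ?exprn_ge0// lerDl.
apply: le_trans (birkhoff_perturb a b q x
  (fun z => smooth_is_derive 1 z hs) hM2) _.
rewrite mulrCA ler_pM// ?mulr_ge0 ?exprn_ge0 ?lerDr//.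
apply: le_trans (ler_wpM2l (exprn_ge0 2 (ltW qR)) ab) _.
by rewrite expr2 mulrA mulfK ?gt_eqF.
Qed.

(** The cocycle identity [birkhoffD] restarts the sum at a shifted point after every [q] steps,
    which is why both bounds are uniform in the base point. *)
Lemma birkhoff_blocks a f B L (q b s : nat) x :
  (forall z, `|birkhoff a f q z| <= B) -> (forall z, `|birkhoff a f s z| <= L) ->
  `|birkhoff a f (b * q + s) x| <= b%:R * B + L.
Proof.
move=> qB sL; elim: b x => [|b IH] x; first by rewrite mul0n mul0r add0r.
rewrite mulSn -addnA birkhoffD; apply: le_trans (ler_normD _ _) _.
by rewrite -natr1 mulrDl mul1r addrAC addrC lerD.
Qed.

(* Writing [j = b q + s] with [s < q]: a good denominator [q] at scale [Q]
   transfers bounds from times below [q] to times up to [n]. *)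
Lemma birkhoff_denominator_step h (r : nat) : periodic h 1 -> smooth h ->
  exists2 M : R, 0 <= M & forall a (p : int) (q Q n : nat) L,
    (0 < q <= Q)%N -> coprimez p q%:Z -> `|q%:R * a - p%:~R| < Q%:R^-1 ->
    (forall s x, (s < q)%N -> `|birkhoff a (derive1n 1 h) s x| <= L) ->
    forall j x, (j <= n)%N -> `|birkhoff a (derive1n 1 h) j x| <=
      L + M * (n%:R / q%:R ^+ r.+1 + n%:R / Q%:R).
Proof.
move=> h1 hs; have [M M0 hM] := birkhoff_approx_le r h1 hs.
exists M => // a p q Q n L qQ cpq apq HL j x jn.
have q0 : (0 < q)%N by case/andP: qQ.
have qR : 0 < q%:R :> R by rewrite ltr0n.
rewrite (divn_eq j q).
apply: le_trans (birkhoff_blocks _ _ (fun z => hM a p q Q z qQ cpq apq)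
  (fun z => HL (j %% q)%N z (ltn_pmod j q0))) _.
rewrite addrC lerD2l mulrCA ler_wpM2l//.
have : (j %/ q)%:R <= n%:R / q%:R :> R.
  rewrite ler_pdivlMr// -natrM ler_nat; apply: leq_trans jn.
  exact: leq_trunc_div.
move=> /(ler_wpM2r _) /le_trans; apply.
  by rewrite addr_ge0 ?divr_ge0 ?invr_ge0 ?exprn_ge0.
by rewrite mulrDr exprS invfM !mulrA divfK ?gt_eqF.
Qed.

(** * Times at which the Birkhoff sums of [h'] are at most of order [n^tau] *)

Lemma irrational_gap a (N : nat) : irrational a ->
  exists2 eta : R, 0 < eta & forall (p : int) (q : nat),
    (0 < q <= N)%N -> eta <= `|q%:R * a - p%:~R|.
Proof.
move=> ia; elim: N => [|N [eta eta0 IH]].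
  by exists 1 => // p q /andP[q0 q1]; move: (leq_trans q0 q1).
set x := N.+1%:R * a; set m := Num.floor x.
have /andP[mx xm] := floor_itv x; rewrite -/m intrD in mx xm.
have {}mx : m%:~R < x.
  rewrite lt_neqAle mx andbT; apply: contra_notN ia => /eqP mx'.
  exists (m%:~R / N.+1%:R) => //.
  by rewrite fmorph_div/= ratr_int ratr_nat mx' /x mulrAC divff ?mul1r.
(* By irrationality [x] lies strictly between two consecutive integers, and no integer is closer to
   it than the nearer of these. *)
exists (Num.min eta (Num.min (x - m%:~R) (m%:~R + 1 - x))).
  by rewrite !lt_min eta0; lra.
move=> p q /andP[q0]; rewrite leq_eqVlt => /orP[/eqP ->|qN]; last first.
  by rewrite ge_min IH ?q0.
rewrite -/x !ge_min; have [pm|pm] := leP p m.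
  have : p%:~R <= m%:~R :> R by rewrite ler_int.
  by move=> pm'; rewrite ger0_norm ?lerD2l ?lerN2 ?pm' ?orbT//; lra.
have : (m + 1)%:~R <= p%:~R :> R by rewrite ler_int lezD1.
rewrite intrD => pm'; rewrite distrC ger0_norm; last by lra.
by rewrite lerD2r pm' !orbT.
Qed.

Lemma natr_le_exp M (k : nat) : 0 <= M -> 1 + k%:R * M <= (1 + M) ^+ k.
Proof.
move=> M0; elim: k => [|k IH]; first by rewrite mul0r addr0 expr0.
rewrite exprS; apply: le_trans (ler_wpM2l _ IH); last by rewrite addr_ge0.
have := mulr_ge0 (mulr_ge0 M0 M0) (ler0n R k); rewrite -natr1; nra.
Qed.

Lemma birkhoff_slow_times h a tau : irrational a -> periodic h 1 -> smooth h ->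
  0 < tau -> exists2 C : R, 0 <= C & forall N : nat, exists2 n : nat, (N < n)%N &
    forall j x, (j <= n)%N -> `|birkhoff a (derive1n 1 h) j x| <= C * n%:R `^ tau.
Proof.
move=> ia h1 hs tau0.
(* This makes [(r + 1) tau >= 1], so that [q <= n^tau] for [n = q^(r+1)]. *)
pose r := Num.trunc tau^-1.
have rtau : 1 <= r.+1%:R * tau.
  rewrite -ler_pdivrMr// div1r ltW//.
  by have /andP[] := truncn_itv (ltW (etrans (invr_gt0 tau) tau0)).
have [M M0 hM] := birkhoff_denominator_step r h1 hs.
have [M1 M10 hM1] := periodic_smooth_bounded 1 h1 hs.
pose good k := forall (p : int) (q : nat), (0 < q <= 2 ^ k)%N ->
  coprimez p q%:Z -> `|q%:R * a - p%:~R| < (2 ^ k)%:R^-1 ->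
  (2 ^ k <= q ^ r.+1)%N.
have [[k0 good_k0]|bad] :=
    pselect (exists k0, forall k, (k0 <= k)%N -> good k).
- pose A : R := (2 ^ k0)%:R * M1.
  have A0 : 0 <= A by rewrite mulr_ge0.
  (* Doubling the time costs a bounded amount: with [n = 2Q] and [q^(r+1) >= Q], both [n / q^(r+1)]
     and [n / Q] are at most 2, whence [4 * M]. *)
  have growth i j x : (j <= 2 ^ (k0 + i))%N ->
      `|birkhoff a (derive1n 1 h) j x| <= A + i%:R * (4 * M).
    elim: i j x => [|i IH] j x jk.
      rewrite mul0r addr0; apply: le_trans (birkhoff_le _ _ _ hM1) _.
      by rewrite ler_wpM2r// ler_nat -(addn0 k0).
    have Q0 : (0 < 2 ^ (k0 + i))%N by rewrite expn_gt0.
    have [p [q [qQ cpq apq]]] := dirichlet_approximation a Q0.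
    have qr := good_k0 _ (leq_addr i k0) p q qQ cpq apq.
    have IHq s z : (s < q)%N ->
        `|birkhoff a (derive1n 1 h) s z| <= A + i%:R * (4 * M).
      by move=> sq; apply: IH; apply: leq_trans (ltnW sq) _; case/andP: qQ.
    apply: le_trans (hM _ _ _ _ _ _ qQ cpq apq IHq _ _ jk) _.
    have -> : A + i.+1%:R * (4 * M) = A + i%:R * (4 * M) + M * 4.
      by rewrite -natr1; ring.
    rewrite lerD2l ler_wpM2l//.
    have QR : 0 < (2 ^ (k0 + i))%:R :> R by rewrite ltr0n.
    rewrite addnS expnS natrM mulfK ?gt_eqF//.
    have : (2 ^ (k0 + i))%:R / q%:R ^+ r.+1 <= 1 :> R.
      rewrite ler_pdivrMr ?mul1r -?natrX ?ler_nat// ltr0n expn_gt0.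
      by case/andP: qQ => ->.
    by rewrite -mulrA; lra.
  (* At [n = 2^k] one has [n^tau = (1 + d)^k], which by Bernoulli's inequality [natr_le_exp]
     dominates the linear growth in [k]. *)
  pose d : R := 2 `^ tau - 1.
  have d0 : 0 < d.
    rewrite subr_gt0 -[ltLHS](_ : 1 `^ tau = 1); last by rewrite powR1.
    by rewrite gt0_ltr_powR// ?nnegrE// ltr1n.
  exists (A + 4 * M / d) => [|N].
    by rewrite addr_ge0// divr_ge0 ?mulr_ge0// ltW.
  exists (2 ^ (k0 + N.+1))%N => [|j x jn].
    apply: leq_ltn_trans (ltn_expl (k0 + N.+1) (ltnSn 1)).
    by rewrite -addSnnS leq_addl.
  apply: le_trans (growth _ _ _ jn) _.
  set k := (k0 + N.+1)%N; have -> : (2 ^ k)%:R `^ tau = (1 + d) ^+ k.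
    rewrite addrC subrK natrX -(powR_mulrn k (ler0n R 2)) -powRrM mulrC.
    by rewrite powRrM powR_mulrn ?powR_ge0.
  have kd := natr_le_exp k (ltW d0).
  have kd1 : 1 <= (1 + d) ^+ k by apply: exprn_ege1; rewrite lerDl ltW.
  have : N.+1%:R <= k%:R :> R by rewrite ler_nat leq_addl.
  move=> Nk; rewrite [leRHS]mulrDl; apply: lerD; first by rewrite ler_peMr.
  rewrite mulrC -[leRHS]mulrA ler_wpM2l ?mulr_ge0// ler_pdivlMl// mulrC.
  by apply: le_trans (ler_wpM2r (ltW d0) Nk) _; lra.
(* Times below [q] have the trivial bound [q M1]; for [n = q^(r+1) < Q = 2^k] the two quotients are
   at most 1 and add [2 * M], which is absorbed since [q >= 1]. *)
- exists (M1 + 2 * M) => [|N]; first by rewrite addr_ge0 ?mulr_ge0.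
  (* From scale [k0] on, an approximation within [1/2^k < eta] excludes denominators up to [N]; this
     forces [n] beyond [N]. *)
  have [eta eta0 gap] := irrational_gap N ia.
  have [k0 k0eta] : exists k0 : nat, eta^-1 < (2 ^ k0)%:R :> R.
    exists (Num.trunc eta^-1).+1; apply: lt_le_trans (truncnS_gt _) _.
    by rewrite ler_nat ltnW// ltn_expl.
  have [k [k0k [p [q [qQ cpq apq qk]]]]] : exists k, (k0 <= k)%N /\
      exists (p : int) (q : nat), [/\ (0 < q <= 2 ^ k)%N, coprimez p q%:Z,
        `|q%:R * a - p%:~R| < (2 ^ k)%:R^-1 & (q ^ r.+1 < 2 ^ k)%N].
    apply: contrapT => H; apply: bad; exists k0 => k k0k p q qQ cpq apq.
    rewrite leqNgt; apply/negP => qk; apply: H.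
    by exists k; split=> //; exists p, q; split.
  have q0 : (0 < q)%N by case/andP: qQ.
  have Nq : (N < q)%N.
    rewrite ltnNge; apply/negP => qN.
    have := gap p q; rewrite q0 => /(_ qN); rewrite leNgt => /negP; apply.
    apply: lt_trans apq _.
    rewrite -[ltRHS]invrK ltf_pV2 ?posrE ?invr_gt0 ?ltr0n ?expn_gt0//.
    by apply: lt_le_trans k0eta _; rewrite ler_nat leq_exp2l.
  exists (q ^ r.+1)%N => [|j x jn].
    by apply: leq_trans Nq _; rewrite -{1}(expn1 q) leq_pexp2l.
  have Lq s z : (s < q)%N -> `|birkhoff a (derive1n 1 h) s z| <= q%:R * M1.
    move=> /ltnW sq; apply: le_trans (birkhoff_le _ _ _ hM1) _.
    by rewrite ler_wpM2r// ler_nat.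
  apply: le_trans (hM _ _ _ _ _ _ qQ cpq apq Lq _ _ jn) _.
  have q1 : 1 <= q%:R :> R by rewrite ler1n.
  have qn : q%:R <= (q ^ r.+1)%:R `^ tau.
    rewrite natrX -powR_mulrn// -powRrM -{1}(powRr1 (ler0n R q)).
    by rewrite ler_powR.
  have -> : (q ^ r.+1)%:R / q%:R ^+ r.+1 = 1 :> R.
    by rewrite natrX divff// expf_neq0// gt_eqF// ltr0n.
  have : (q ^ r.+1)%:R / (2 ^ k)%:R <= 1 :> R.
    by rewrite ler_pdivrMr ?mul1r ?ler_nat ?ltr0n ?expn_gt0// ltnW.
  move: (_ / _) => t t1; apply: le_trans (ler_wpM2l _ qn); last first.
    by rewrite addr_ge0 ?mulr_ge0.
  have := ler_wpM2l M0 t1; have := ler_wpM2l M0 q1; lra.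
Qed.

End SmoothPeriodic.

(** * The product metric on the torus *)

Section TorusDistance.
Variable R : realType.
Implicit Types (s t e : R) (x y : torus R).

Lemma dist_int_lb t : has_lbound [set `|t - n%:~R| | n in [set: int]].
Proof. by exists 0 => _ [n _ <-]. Qed.

Lemma dist_int_le t (n : int) : dist_int t <= `|t - n%:~R|.
Proof. by apply: ge_inf; [exact: dist_int_lb|exists n]. Qed.

Lemma dist_int_ge0 t : 0 <= dist_int t.
Proof.
apply: lb_le_inf; first by exists `|t - 0%:~R|, 0.
by move=> _ [n _ <-].
Qed.

Lemma dist_int_le1 t : dist_int t <= 1.
Proof.
apply: le_trans (dist_int_le t (Num.floor t)) _.
by have := floor_itv t; rewrite intrD ler_norml; lra.
Qed.

Lemma to_circleB s t : to_circle (s - t) = to_circle s - to_circle t.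
Proof. by rewrite -[s in RHS](subrK t) [in RHS]to_circleD addrK. Qed.

Lemma circle_normB_le s t : circle_norm (to_circle s - to_circle t) <= `|s - t|.
Proof.
by rewrite -to_circleB circle_normE; have := dist_int_le (s - t) 0; rewrite subr0.
Qed.

Lemma circle_lift (z : circle R) : exists t : R, 0 <= t < 1 /\ to_circle t = z.
Proof.
exists (repr z - (Num.floor (repr z))%:~R); split.
  by have := floor_itv (repr z); rewrite intrD; lra.
rewrite -[RHS]reprK; apply/to_circleP.
by rewrite addrC addKr rpredN intr_int.
Qed.

Lemma torus_lift y : exists2 u : nat -> R, (forall k, 0 <= u k < 1) &
  y = (fun k => to_circle (u k)).
Proof.
have /choice[u uP] := fun k => circle_lift (y k).
by exists u => [k|]; [case: (uP k)|apply/funext => k; case: (uP k)].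
Qed.

(** The induction carries the tail still missing, [2^-1 ^+ maxn K n]. The case [K = 0] bounds the
    total weight by 1. *)
Lemma geometric_tail_le (K n : nat) :
  \sum_(0 <= k < n) (2 ^+ k.+1)^-1 * (K <= k)%:R <= 2^-1 ^+ K :> R.
Proof.
suff : \sum_(0 <= k < n) (2 ^+ k.+1)^-1 * (K <= k)%:R <=
    2^-1 ^+ K - 2^-1 ^+ maxn K n :> R.
  by move/le_trans; apply; rewrite gerBl exprn_ge0 ?invr_ge0.
elim: n => [|n IH]; first by rewrite big_nil maxn0 subrr.
rewrite big_nat_recr//=.
have [Kn|nK] := leqP K n.
  move: IH; rewrite (maxn_idPr Kn) (maxn_idPr (leqW Kn)) mulr1.
  by rewrite -exprVn exprS; lra.
by rewrite mulr0 addr0 (maxn_idPl nK); move: IH; rewrite (maxn_idPl (ltnW nK)).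
Qed.

(** Coordinates below [K] have total weight at most 1; the others contribute at most their weight,
    since [circle_norm] never exceeds 1. This reduces covering to finitely many coordinates. *)
Lemma torus_dist_le x y (K : nat) (delta : R) : 0 <= delta ->
  (forall k, (k < K)%N -> circle_norm (x k - y k) <= delta) ->
  torus_dist x y <= delta + 2^-1 ^+ K.
Proof.
move=> delta0 xy; rewrite /torus_dist.
have c0 k : 0 <= (2 ^+ k.+1)^-1 * circle_norm (x k - y k) :> R.
  by rewrite mulr_ge0 ?invr_ge0 ?exprn_ge0//; exact: dist_int_ge0.
set u := series _.
have uB n : u n <= delta + 2^-1 ^+ K.
  rewrite /u /series/=.
  apply: (@le_trans _ _ (\sum_(0 <= k < n) (2 ^+ k.+1)^-1 * (0 <= k)%:R * delta
      + \sum_(0 <= k < n) (2 ^+ k.+1)^-1 * (K <= k)%:R)).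
    rewrite -big_split/=; apply: ler_sum => k _.
    rewrite mulr1 -mulrDr ler_wpM2l ?invr_ge0 ?exprn_ge0//.
    have [Kk|kK] := leqP K k; last by rewrite addr0 xy.
    by apply: le_trans (dist_int_le1 _) _; rewrite lerDr.
  apply: lerD; last exact: geometric_tail_le.
  rewrite -mulr_suml -[leRHS]mul1r ler_wpM2r//.
  by have := geometric_tail_le 0 n; rewrite expr0.
(* [limn] is informative only once convergence is known; here the partial sums are monotone and
   bounded. *)
apply: limr_le; last exact: nearW.
apply: nondecreasing_is_cvgn; first exact: nondecreasing_series.
by exists (delta + 2^-1 ^+ K) => _ [n _ <-].
Qed.

End TorusDistance.

(** * Covering the torus by [dbar] balls *)

Lemma grid_approx (R : realType) (t : R) (N : nat) : 0 <= t < 1 -> (0 < N)%N ->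
  exists i : 'I_N, `|i%:R / N%:R - t| <= N%:R^-1.
Proof.
move=> /andP[t0 t1] N0; have NR : 0 < N%:R :> R by rewrite ltr0n.
have /andP[it ti] := truncn_itv (mulr_ge0 t0 (ltW NR)).
have iN : (Num.trunc (t * N%:R) < N)%N.
  by rewrite -(ltr_nat R); apply: le_lt_trans it _; rewrite gtr_pMl.
exists (Ordinal iN); rewrite /= -(ler_pM2r NR) mulVf ?gt_eqF//.
rewrite -[X in _ * X <= _](gtr0_norm NR) -normrM mulrBl divfK ?gt_eqF//.
by move: it ti; rewrite -natr1 ler_norml; lra.
Qed.

Section Covering.
Variables (R : realType) (alpha beta : R) (h : R -> R).
Hypotheses (h1 : periodic h 1) (hs : smooth h).
Let T := torus_map alpha beta h.

Lemma iter_torus_mapE (u : nat -> R) (j : nat) :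
  iter j T (fun k => to_circle (u k)) =
  (fun k => to_circle (match k with
    | 0%N => u 0%N + j%:R * alpha
    | k'.+1 => u k'.+1 + birkhoff alpha h j (u 0%N + k'%:R * beta)
    end)).
Proof.
elim: j => [|j IH] /=.
  apply/funext => -[|k]; first by rewrite mul0r addr0.
  by rewrite /birkhoff big_ord0 addr0.
rewrite IH /T torus_mapE//; apply/funext => -[|k].
  by rewrite -natr1 mulrDl mul1r addrA.
by rewrite /birkhoff big_ord_recr/= addrA (addrAC (u 0%N)).
Qed.

Lemma dbar_le (n : nat) (x y : torus R) (c : R) : (0 < n)%N ->
  (forall j, (j < n)%N -> torus_dist (iter j T x) (iter j T y) <= c) ->
  dbar (@torus_dist R) T n x y <= c.
Proof.
move=> n0 xy; rewrite /dbar ler_pdivrMl ?ltr0n// mulr_natl.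
rewrite -[X in _ *+ X]subn0 -sumr_const_nat.
by apply: ler_sum_nat => j /andP[_ jn]; exact: xy.
Qed.

(* Displacing the first coordinate by [d0] moves the others by at most [L * d0],
   [L] being a Lipschitz constant of the Birkhoff sum; displacements of the other
   coordinates are not amplified. *)
Lemma torus_orbit_dist_le (u v : nat -> R) (K j : nat) (d0 d1 L : R) :
  0 <= d1 -> 0 <= L ->
  (forall x, `|birkhoff alpha (derive1n 1 h) j x| <= L) ->
  `|u 0%N - v 0%N| <= d0 ->
  (forall k, (k < K)%N -> `|u k.+1 - v k.+1| <= d1) ->
  torus_dist (iter j T (fun k => to_circle (u k)))
             (iter j T (fun k => to_circle (v k)))
    <= d1 + (L + 1) * d0 + 2^-1 ^+ K.+1.
Proof.
move=> d10 L0 hL uv0 uv; rewrite /T !iter_torus_mapE//.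
have d00 : 0 <= d0 by exact: le_trans (normr_ge0 _) uv0.
apply: torus_dist_le; first by rewrite addr_ge0 ?mulr_ge0 ?addr_ge0.
have Ld0 : 0 <= L * d0 by exact: mulr_ge0.
case=> [_|k kK]; apply: le_trans (circle_normB_le _ _) _.
  by rewrite opprD addrACA subrr addr0; lra.
rewrite opprD addrACA; apply: le_trans (ler_normD _ _) _.
apply: lerD; first exact: uv.
have dS (z : R) : is_derive z 1 (birkhoff alpha h j)
    (birkhoff alpha (derive1n 1 h) j z).
  by apply: is_derive_birkhoff => w; exact: (smooth_is_derive 0).
apply: le_trans (mvt_lipschitz _ _ dS hL) _.
rewrite opprD addrACA subrr addr0.
by apply: le_trans (ler_wpM2l L0 uv0) _; rewrite mulrDl mul1r lerDl.
Qed.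

(** Only the grid of the first coordinate, with [N] points, must be refined as [L] grows. The next
    [K] coordinates use a fixed grid of [M] points and the rest are set to 0, so the count
    [N * M ^ K] is linear in [L]. *)
Lemma torus_covering (e : R) : 0 < e ->
  exists2 C : R, 0 <= C & forall (n : nat) (L : R), (0 < n)%N -> 0 <= L ->
    (forall j x, (j <= n)%N -> `|birkhoff alpha (derive1n 1 h) j x| <= L) ->
    exists m : nat, [/\ (0 < m)%N, m%:R <= C * (L + 1) &
      exists x : 'I_m -> torus R, forall y, exists i : 'I_m,
        dbar (@torus_dist R) T n (x i) y < e].
Proof.
move=> e0; pose e4 := e / 4.
have e40 : 0 < e4 by rewrite divr_gt0.
have [K Ke] : exists K : nat, 2^-1 ^+ K.+1 < e4.
  exists (Num.trunc e4^-1); rewrite exprVn invf_plt ?posrE ?exprn_gt0//.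
  apply: lt_le_trans (truncnS_gt _) _.
  by rewrite -natrX ler_nat ltnW// ltn_expl.
pose M := (Num.trunc e4^-1).+1.
have Me : M%:R^-1 < e4 :> R by rewrite invf_plt ?posrE ?ltr0n// truncnS_gt.
(* As [L >= 0], [N <= (L + 1) / e4 + 1 <= (e4^-1 + 1) (L + 1)]. *)
exists ((e4^-1 + 1) * (M ^ K)%:R).
  by rewrite mulr_ge0// addr_ge0// invr_ge0 ltW.
move=> n L n0 L0 hL.
have L1 : 0 < L + 1 by rewrite ltr_wpDl.
pose N := (Num.trunc ((L + 1) / e4)).+1.
have Ne : (L + 1) / N%:R < e4.
  by rewrite ltr_pdivrMr ?ltr0n// -ltr_pdivrMl// mulrC truncnS_gt.
pose I := ('I_N * {ffun 'I_K -> 'I_M})%type.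
have cardI : #|{: I}| = (N * M ^ K)%N by rewrite card_prod card_ffun !card_ord.
exists #|{: I}|; split.
- by rewrite cardI muln_gt0 expn_gt0.
- rewrite cardI natrM mulrAC ler_wpM2r// /N -natr1.
  have /andP[tL _] := truncn_itv (ltW (divr_gt0 L1 e40)).
  apply: le_trans (lerD tL (lexx 1)) _.
  rewrite [leRHS]mulrDl mul1r [e4^-1 * _]mulrC.
  by apply: lerD; rewrite ?lerDr.
pose pt (i : I) k : R := if k is k'.+1 then
    (if insub k' is Some k'' then (i.2 k'')%:R / M%:R else 0)
  else i.1%:R / N%:R.
exists (fun i k => to_circle (pt (enum_val i) k)) => y.
have [v v01 ->] := torus_lift y.
have [i0 i0P] := grid_approx (v01 0%N) (ltn0Sn _ : (0 < N)%N).
have /choice[f fP] := fun k : 'I_K =>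
  grid_approx (v01 k.+1) (ltn0Sn _ : (0 < M)%N).
exists (enum_rank ((i0, [ffun k => f k]) : I)); rewrite enum_rankK.
(* The errors from the fixed grids, from the amplified first coordinate and from the tail are each
   below [e / 4]. *)
apply: (@le_lt_trans _ _ (M%:R^-1 + (L + 1) * N%:R^-1 + 2^-1 ^+ K.+1)); last first.
  by rewrite [ltRHS](_ : e = e4 + e4 + e4 + e4); [lra|rewrite /e4; field].
apply: dbar_le => // j /ltnW jn.
apply: torus_orbit_dist_le => //.
  by move=> x; exact: hL.
by move=> k kK /=; rewrite insubT/= ffunE; exact: (fP (Ordinal kK)).
Qed.

End Covering.

(** * From infinitely many slow times to the lower limit *)

Lemma limn_einf_eq0 (R : realType) (u : (\bar R)^nat) :
  (forall n, 0 <= u n)%E ->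
  (forall (e : R) (N : nat), 0 < e -> exists2 n, (N <= n)%N & (u n <= e%:E)%E) ->
  limn_einf u = 0%E.
Proof.
move=> u0 ue; apply/eqP; rewrite limn_einf_lim eq_le; apply/andP; split.
  apply/lee_addgt0Pr => e e0; rewrite add0e.
  apply: lime_le; first exact: is_cvg_einfs.
  apply: nearW => N; have [n Nn une] := ue e N e0.
  by apply: le_trans une; apply: ereal_inf_lbound; exists n.
apply: lime_ge; first exact: is_cvg_einfs.
by apply: nearW => N; apply: le_ereal_inf_tmp => _ [n _ <-].
Qed.

Theorem theorem3p2 (R : realType) (alpha beta : R) (h : R -> R)
    (nu : probability (borel (torus R)) R) :
  irrational alpha -> irrational beta ->
  periodic h 1 -> smooth h ->
  invariant_measures (torus_map alpha beta h) nu ->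
  subpolynomial_complexity (@torus_dist R) (torus_map alpha beta h) nu.
Proof.
move=> ia _ h1 hs _ tau e tau0 e0.
set T := torus_map alpha beta h.
have span_ge0 n : (0 <= span_number (@torus_dist R) T nu n e)%E.
  by apply: le_ereal_inf_tmp => _ [m _ <-]; rewrite lee_fin.
have [C C0 cover] := torus_covering alpha beta h1 hs e0.
(* With exponent [tau / 2] the covering number is at most [A n^(tau/2)], and the other half of
   [n^tau] makes the ratio small. *)
have tau2 : 0 < tau / 2 by rewrite divr_gt0.
have [B B0 slow] := birkhoff_slow_times ia h1 hs tau2.
apply: limn_einf_eq0 => [n|d N d0].
  by rewrite mule_ge0// lee_fin invr_ge0 powR_ge0.
pose A := C * (B + 1).
have A0 : 0 <= A by rewrite mulr_ge0// addr_ge0.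
(* The second threshold ensures [A / d <= n^(tau/2)]. *)
pose N' := maxn N (Num.trunc ((A / d) `^ (2 / tau))).+1.
have [n N'n hL] := slow N'.
have n0 : (0 < n)%N by exact: leq_ltn_trans N'n.
(* Time [n] sits at index [n.-1] because the sequence starts at time 1. *)
exists n.-1; first by rewrite -ltnS prednK// (leq_ltn_trans _ N'n)// leq_maxl.
rewrite prednK//.
have nR : 0 < n%:R :> R by rewrite ltr0n.
pose t := n%:R `^ (tau / 2) : R.
have t1 : 1 <= t.
  by rewrite -(powRr0 n%:R) ler_powR ?ler1n// ltW.
have [m [m0 mC [x xP]]] := cover n _ n0 (mulr_ge0 B0 (powR_ge0 _ _)) hL.
(* The balls cover the whole torus, so their union has measure [1 > 1 - e]. *)
have spanm : (span_number (@torus_dist R) T nu n e <= m%:R%:E)%E.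
  apply: ereal_inf_lbound; exists m => //; split=> //; exists x.
  rewrite [X in nu X](_ : _ = setT); last first.
    by apply/seteqP; split=> // y _; have [i iy] := xP y; exists i.
  by rewrite probability_setT lte_fin; lra.
have mA : m%:R <= A * t.
  apply: le_trans mC _; rewrite /A -mulrA ler_wpM2l//.
  by rewrite -/t; lra.
have tt : n%:R `^ tau = t * t.
  rewrite /t -powRD; last by rewrite (gt_eqF nR) implybT.
  by congr (_ `^ _); field.
have tA : A <= d * t.
  rewrite -ler_pdivrMl// mulrC.
  have Ad0 : 0 <= A / d by exact: divr_ge0 A0 (ltW d0).
  have -> : A / d = ((A / d) `^ (2 / tau)) `^ (tau / 2).
    rewrite -powRrM [X in _ `^ X](_ : _ = 1) ?powRr1//.
    by field; rewrite gt_eqF.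
  rewrite /t ge0_ler_powR ?nnegrE ?powR_ge0//; first exact: ltW.
  apply: ltW; apply: lt_le_trans (truncnS_gt _) _.
  by rewrite ler_nat; apply: leq_trans (ltnW N'n); exact: leq_maxr.
apply: (@le_trans _ _ (m%:R%:E * ((n%:R `^ tau)^-1)%:E)%E).
  by rewrite lee_wpmul2r// lee_fin invr_ge0 powR_ge0.
have t0 : 0 < t by exact: lt_le_trans t1.
rewrite -EFinM lee_fin ler_pdivrMr tt ?mulr_gt0// mulrA.
by apply: le_trans mA _; rewrite ler_wpM2r// ltW.
Qed.
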